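(* Let $1\le k\le r-1$ and let $\lambda$ be a $(k,r)$-admissible Young diagram with $n$ boxes. Then the $r$-conjugate $\lambda_r^*$ is $(r-k,r)$-admissible and the representation $\rho_{\lambda_r^*}^{(r-k,r)}$ of $B_n$ is equivalent to $\chi\otimes(\rho_\lambda^{(k,r)})^*$, where $(\rho_\lambda^{(k,r)})^*$ is the contragredient representation and $\chi:B_n\to U(1)$ is the character with $\chi(\sigma_i)=-q$ for all $i$.
   Context: Fix an integer $r\ge 3$ and let $q=e^{2\pi i/r}$ or $q=e^{-2\pi i/r}$, with $q^{1/2}=e^{\pm\pi i/r}$ (same sign). Quantum integers: $[m]=\frac{q^{m/2}-q^{-m/2}}{q^{1/2}-q^{-1/2}}$. A Young diagram $\lambda=[\lambda_1,\dots,\lambda_k]$, $\lambda_1\ge\dots\ge\lambda_k\ge0$, has $n=\sum\lambda_i$ boxes; a standard tableau is a filling by $1,\dots,n$ increasing along rows and columns. For $r\ge k+1$, $\lambda$ (at most $k$ rows) is $(k,r)$-admissible if $\lambda_1-\lambda_k\le r-k$. For a standard tableau $t$, $t^{(i)}$ is obtained by deleting boxes containing $n,\dots,n-i+1$; $t$ is $(k,r)$-admissible if every $t^{(i)}$ has $(k,r)$-admissible shape. If entries $m,m'$ lie in rows $r_1,r_2$ and columns $c_1,c_2$, $d_{t,m,m'}=(c_1-c_2)-(r_1-r_2)$; with $d=d_{t,i,i+1}$ put $\alpha_{t,i}=\frac{[d+1]}{[2][d]}$, $\beta_{t,i}=\sqrt{\alpha_{t,i}(1-\alpha_{t,i})}$.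 $V_\lambda^{(k,r)}$ has orthonormal basis $\{v_t\}$ over $(k,r)$-admissible standard tableaux $t$ of shape $\lambda$; $s_i(t)$ swaps $i,i+1$; $E_iv_t=\alpha_{t,i}v_t+\beta_{t,i}v_{s_i(t)}$ if $s_i(t)$ is an admissible standard tableau, else $E_iv_t=\alpha_{t,i}v_t$. The Jones–Wenzl sector $\rho_\lambda^{(k,r)}:B_n\to U(V_\lambda^{(k,r)})$ is $\sigma_i\mapsto q\,\mathrm{Id}-(1+q)E_i$. $r$-tile and $r$-conjugate: for a $(k,r)$-admissible $\lambda$ with $k$ rows and $l=r-k$, $T_\lambda$ is the $k\times l$ matrix with entries $t_{ij}=\lfloor(\lambda_i+l-j)/l\rfloor$; the $r$-conjugate $\lambda_r^*$ is the Young diagram (with at most $l$ rows) whose $i$-th row has $\sum_{j=1}^{k}t_{ji}$ boxes, i.e. the diagram associated with the transpose of $T_\lambda$ (a diagram associated with a tile has $i$-th row length equal to the $i$-th row sum of the tile). *)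

(* Defs.v *)
From HB Require Import structures.
From mathcomp Require Import all_boot all_order all_algebra all_fingroup all_field.
Set Implicit Arguments. Unset Strict Implicit. Unset Printing Implicit Defensive.
Import Order.TTheory GRing.Theory Num.Theory.

(* ---------- Young diagrams (as k-tuples of row lengths, zeros allowed) ---- *)
Definition is_young (lam : seq nat) : bool := sorted geq lam.

(* (k,r)-admissible: at most k rows (padded to exactly k), lam_1 - lam_k <= r-k *)
Definition admissible (k r : nat) (lam : seq nat) : bool :=
  [&& size lam == k, is_young lam & (nth 0 lam 0 - nth 0 lam k.-1 <= r - k)%N].

(* r-tile T_lam (k x l, l = r - k), 0-indexed: t_{ij} = floor((lam_i + l - j)/l) *)
Definition rtile (r k : nat) (lam : seq nat) (i j : nat) : nat :=
  (nth 0 lam i + (r - k) - j.+1) %/ (r - k).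
(* r-conjugate: i-th row = i-th column sum of T_lam (= row sum of transpose) *)
Definition rconj (r k : nat) (lam : seq nat) : seq nat :=
  [seq \sum_(j < k) rtile r k lam j i | i <- iota 0 (r - k)].

(* A filling of a diagram with rows < k by 1..n: entry m+1 (m : 'I_n) sits in
   box (row, column) = t m (0-indexed). *)
Definition tab (k n : nat) := {ffun 'I_n -> 'I_k * 'I_n}.

Definition standard k n (lam : seq nat) (t : tab k n) : bool :=
  [&& sumn lam == n, injectiveb (fun m => t m),
      [forall m, ((t m).2 < nth 0 lam (t m).1)%N] &
      [forall m, forall m',
         ((((t m).1 == (t m').1) && (((t m').2 : nat) == (t m).2.+1)) ==> (m < m')%N) &&
         ((((t m).2 == (t m').2) && (((t m').1 : nat) == (t m).1.+1)) ==> (m < m')%N)]].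

(* row lengths of the shape of t^{(n-m)} (boxes holding entries 1..m) *)
Definition shape_at k n (t : tab k n) (m : nat) : seq nat :=
  [seq #|[set p : 'I_n | ((p < m)%N && ((t p).1 == j))]| | j <- enum 'I_k].

Definition adm_tab k r n (lam : seq nat) (t : tab k n) : bool :=
  standard lam t && [forall m : 'I_n.+1, admissible k r (shape_at t m)].

(* the generator letter i : 'I_n.-1 stands for sigma_{i+1}, acting on the
   entries i+1, i+2, i.e. on the 0-indexed ordinals lo i and hi i *)
Definition lo n (i : 'I_n.-1) : 'I_n := widen_ord (leq_pred n) i.
Definition hi n (i : 'I_n.-1) : 'I_n := insubd (lo i) i.+1.

Definition swap_tab k n (i : 'I_n.-1) (t : tab k n) : tab k n :=
  [ffun m => t (tperm (lo i) (hi i) m)].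

Definition dcont k n (t : tab k n) (i : 'I_n.-1) : int :=
  ((((t (lo i)).2 : nat)%:Z - ((t (hi i)).2 : nat)%:Z) -
   (((t (lo i)).1 : nat)%:Z - ((t (hi i)).1 : nat)%:Z))%R.

Local Open Scope ring_scope.

(* quantum integer [m] with q^{1/2} = s *)
Definition qint (s : algC) (m : int) : algC := (s ^ m - s ^ (- m)) / (s - s^-1).

Definition alpha (s : algC) k n (t : tab k n) (i : 'I_n.-1) : algC :=
  qint s (dcont t i + 1) / (qint s 2 * qint s (dcont t i)).
Definition beta (s : algC) k n (t : tab k n) (i : 'I_n.-1) : algC :=
  sqrtC (alpha s t i * (1 - alpha s t i)).

(* index set of the orthonormal basis of V_lam^{(k,r)} *)
Definition Atab k r n (lam : seq nat) : {set tab k n} := [set t | adm_tab r lam t].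

(* matrix of E_i in the basis (v_t): column t holds the coordinates of E_i v_t *)
Definition Emx (s : algC) k r n (lam : seq nat) (i : 'I_n.-1)
  : 'M[algC]_#|Atab k r n lam| :=
  \matrix_(x, y)
    ((if enum_val x == enum_val y then alpha s (enum_val y) i else 0) +
     (if (enum_val x == swap_tab i (enum_val y))
         && (swap_tab i (enum_val y) \in Atab k r n lam)
      then beta s (enum_val y) i else 0)).

(* words in the generators sigma_i^{+-1} of B_n (true = sigma_i, false = its
   inverse); every element of B_n is represented by such a word *)
Definition word (n : nat) := seq ('I_n.-1 * bool).

Definition word_eval d n (A : 'I_n.-1 -> 'M[algC]_d) (w : word n) : 'M[algC]_d :=
  foldr (fun x M => (if x.2 then A x.1 else invmx (A x.1)) *m M) 1%:M w.

Definition JW_gen (s : algC) k r n lam (i : 'I_n.-1) : 'M[algC]_#|Atab k r n lam| :=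
  (s ^+ 2)%:M - (1 + s ^+ 2) *: @Emx s k r n lam i.

Definition JW_rep (s : algC) k r n lam : word n -> 'M[algC]_#|Atab k r n lam| :=
  word_eval (@JW_gen s k r n lam).

Definition chi (s : algC) n (w : word n) : algC :=
  \prod_(x <- w) (if x.2 then - s ^+ 2 else (- s ^+ 2)^-1).

Definition twisted_dual (s : algC) n d (R : word n -> 'M[algC]_d) : word n -> 'M[algC]_d :=
  fun w => chi s w *: (invmx (R w))^T.

Definition rep_equiv n d1 d2 (R1 : word n -> 'M[algC]_d1) (R2 : word n -> 'M[algC]_d2) : Prop :=
  exists (P : 'M[algC]_(d1, d2)) (Q : 'M[algC]_(d2, d1)),
    [/\ P *m Q = 1%:M, Q *m P = 1%:M & forall w, P *m R2 w = R1 w *m P].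

(* Main.v *)
Require Import Defs.
From HB Require Import structures.
From mathcomp Require Import all_boot all_order all_algebra all_fingroup all_field.
From mathcomp Require Import zify ring.
Set Implicit Arguments. Unset Strict Implicit. Unset Printing Implicit Defensive.
Import Order.TTheory GRing.Theory Num.Theory.

(** With [l = r - k], send the box in row [a] and column [c] to the box in row
    [c mod l] and column [k * (c div l) + a]. This map is involutive, it sums the
    contents of a box and of its image to the multiple [r * (c div l)] of [r], and
    adding a box to an admissible diagram adds the image box to its [r]-conjugate.
    Hence it induces a bijection [t -> t^*] between admissible tableaux that commutes
    with the swaps [s_i] and turns the axial distance [d] into [-d] modulo [r].
    Since [q^(1/2)] is a primitive [2r]-th root of unity, the coefficient
    [[d+1]/([2][d])] is [r]-periodic in [d] and becomes [1 -] itself under [d -> -d];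
    so, up to the sign of the off-diagonal entries, the [E_i] of the conjugate sector
    is [1 - E_i]. An alternating weight on tableaux absorbs the sign. Finally each
    [E_i] is a symmetric idempotent, so the contragredient of [q - (1+q) E_i]
    multiplied by [-q] is [q - (1+q) (1 - E_i)]. *)

(** * Row lengths of subtableaux *)

(** Row lengths are a function on all of [nat], of which only the values below [k] matter when
    [k > 0]; the additive bound avoids truncated subtraction. *)
Definition adm (k l : nat) (f : nat -> nat) : Prop :=
  (forall i j, i <= j -> j < k -> f j <= f i) /\ f 0 <= f k.-1 + l.

Lemma eq_adm k l f g : (forall j, j < k -> f j = g j) -> 0 < k -> adm k l f -> adm k l g.
Proof.
move=> fg k_gt0 [f1 f2]; split; last by rewrite -!fg //; lia.
by move=> i j ij jk; rewrite -!fg ?f1 //; lia.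
Qed.

Lemma admissibleP k l lam :
  reflect (size lam = k /\ adm k l (nth 0 lam)) (admissible k (k + l) lam).
Proof.
apply: (iffP and3P) => [[/eqP sz ys]|[sz [f1 f2]]].
  rewrite leq_subLR addnC addKn => f2; split=> //; split; last by rewrite addnC.
  move=> i j ij jk; have := sorted_leq_nth _ _ 0 ys; rewrite -/(geq _ _); apply.
  - by move=> a b c; rewrite /geq /=; lia.
  - by move=> a; rewrite /geq /=.
  - by rewrite inE sz; lia.
  - by rewrite inE sz.
  - exact: ij.
split; first exact/eqP.
  by apply/(sortedP 0) => i; rewrite sz => ik; apply: f1.
by rewrite leq_subLR addKn.
Qed.

Lemma card_ord_lt n c : c <= n -> #|[set i : 'I_n | i < c]| = c.
Proof.
move=> cn; rewrite -[RHS]card_ord.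
have -> : [set i : 'I_n | i < c] = [set widen_ord cn i | i : 'I_c].
  apply/setP => p; rewrite inE; apply/idP/imsetP => [pm|[i _ ->]] /=.
    by exists (Ordinal pm) => //; apply: val_inj.
  exact: ltn_ord.
by rewrite card_imset //; move=> i i' /(congr1 val) /= /val_inj.
Qed.

(** A sum of indicators, so that inserting one entry adds one term and exchanging sums counts
    boxes. *)
Definition sh k n (t : tab k n) (m j : nat) : nat :=
  \sum_(p < n | p < m) ((t p).1 == j :> nat).

Section Shape.
Variables (k n : nat).
Implicit Type t : tab k n.

Lemma nth_shape_at t m j : nth 0 (shape_at t m) j = sh t m j.
Proof.
rewrite /shape_at; have [jk|kj] := ltnP j k; last first.
  rewrite nth_default; last by rewrite size_map size_enum_ord.
  rewrite /sh big1 // => p _; case: eqP => // pj.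
  by have := ltn_ord (t p).1; lia.
have j0 : 'I_k := Ordinal jk.
rewrite (nth_map j0) ?size_enum_ord // -sum1dep_card /sh big_mkcondr /=.
by apply: eq_bigr => p _; rewrite -val_eqE /= nth_enum_ord //; case: eqP.
Qed.

Lemma size_shape_at t m : size (shape_at t m) = k.
Proof. by rewrite size_map size_enum_ord. Qed.

Lemma sh0 t j : sh t 0 j = 0.
Proof. by rewrite /sh big_pred0. Qed.

Lemma shS t (m : 'I_n) j : sh t m.+1 j = sh t m j + ((t m).1 == j :> nat).
Proof.
rewrite /sh (bigD1 m) //= addnC; congr (_ + _).
by apply: eq_bigl => p; rewrite -val_eqE /=; lia.
Qed.

Lemma leq_sh t m m' j : m <= m' -> sh t m j <= sh t m' j.
Proof.
move=> mm'; rewrite /sh [X in X <= _]big_mkcond [X in _ <= X]big_mkcond.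
by apply: leq_sum => p _; case: ifP => // pm; rewrite (leq_trans pm mm').
Qed.

Lemma ltn_sh t (p : 'I_n) m : p < m -> sh t p (t p).1 < sh t m (t p).1.
Proof. by move=> /(leq_sh t (t p).1); rewrite shS eqxx addn1. Qed.

Lemma sum_sh t m : m <= n -> \sum_(j < k) sh t m j = m.
Proof.
move=> mn; rewrite /sh exchange_big /=.
under eq_bigr => p _.
  rewrite (bigD1 (t p).1) //= eqxx big1 ?addn0; last first.
    by move=> j; rewrite -val_eqE /= eq_sym => /negPf ->.
  over.
by rewrite sum1_card -[RHS](card_ord_lt mn) cardsE.
Qed.

End Shape.

Lemma sumn_nth k lam : size lam = k -> sumn lam = \sum_(j < k) nth 0 lam j.
Proof. by move=> <-; rewrite sumnE (big_nth 0) big_mkord. Qed.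

(** * Standard fillings: entries against row lengths *)

Section Standard.
Variables (k n : nat) (lam : seq nat) (t : tab k n).
Hypothesis sz_lam : size lam = k.
Hypothesis std : standard lam t.

(** The filling is injective into the boxes of the diagram, and these number exactly [n]. *)
Lemma standard_surj (j : 'I_k) c : c < nth 0 lam j ->
  exists2 p, (t p).1 = j & (t p).2 = c :> nat.
Proof.
case/and4P: std => /eqP sum_n /injectiveP t_inj /forallP t_in _ c_lt.
have le_lam (i : 'I_k) : nth 0 lam i <= n.
  by rewrite -sum_n (sumn_nth sz_lam) (bigD1 i) //= leq_addr.
pose B := [set b : 'I_k * 'I_n | b.2 < nth 0 lam b.1].
have cardB : #|B| = n.
  rewrite -sum1dep_card -(pair_big_dep xpredT
    (fun (i : 'I_k) (c : 'I_n) => c < nth 0 lam i) (fun _ _ => 1)) /=.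
  rewrite -[RHS]sum_n (sumn_nth sz_lam); apply: eq_bigr => i _.
  by rewrite sum1dep_card card_ord_lt.
have /eqP tB : [set t p | p in 'I_n] == B.
  rewrite eqEcard cardB card_imset // card_ord leqnn andbT.
  by apply/subsetP => _ /imsetP[p _ ->]; rewrite inE.
have c_n : c < n by apply: leq_trans c_lt (le_lam j).
have : (j, Ordinal c_n) \in B by rewrite inE.
by rewrite -tB => /imsetP[p _ e]; exists p; rewrite -e.
Qed.

(** [standard] compares adjacent boxes only. The induction runs on the column of [p'] and passes
    through the entry just left of it, which [standard_surj] provides. *)
Lemma standard_row_lt (p p' : 'I_n) : (t p).1 = (t p').1 -> (t p).2 < (t p').2 -> p < p'.
Proof.
case/and4P: std => _ _ /forallP t_in /forallP ord.
have [d] := ubnP (t p').2; elim: d p' => // d IH p' le_d e_row lt_col.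
have [|q q1 q2] := @standard_surj (t p').1 (t p').2.-1.
  by have := t_in p'; lia.
have q_p' : q < p'.
  have /forallP/(_ p')/andP[/implyP + _] := ord q; apply.
  by rewrite q1 eqxx /= q2; lia.
have [e|ne] := eqVneq ((t p).2 : nat) (t q).2; last first.
  by apply: ltn_trans q_p'; apply: IH; rewrite ?q1 ?q2 //; move: ne; rewrite q2; lia.
case/and4P: std => _ /injectiveP t_inj _ _.
suff -> : p = q by [].
by apply: t_inj; rewrite [t p]surjective_pairing [t q]surjective_pairing q1 e_row (val_inj e).
Qed.

Lemma standard_count (j : 'I_k) c : c <= nth 0 lam j ->
  \sum_(p < n | (t p).2 < c) ((t p).1 == j :> nat) = c.
Proof.
move=> c_lam; case/and4P: (std) => /eqP sum_n /injectiveP t_inj /forallP t_in _.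
have c_n : c <= n.
  by rewrite -sum_n (sumn_nth sz_lam) (bigD1 j) //= (leq_trans c_lam) ?leq_addr.
transitivity #|[set p : 'I_n | ((t p).2 < c) && ((t p).1 == j :> nat)]|.
  rewrite -sum1dep_card [RHS]big_mkcondr; apply: eq_bigr => p _; by case: eqP.
rewrite -[RHS](card_ord_lt c_n) -(card_in_imset (f := fun p => (t p).2)).
  apply: eq_card => i; rewrite inE; apply/imsetP/idP => [[p]|i_c].
    by rewrite inE => /andP[? _] ->.
  have [p p1 p2] := standard_surj (leq_trans i_c c_lam).
  by exists p; [rewrite inE p2 i_c p1 eqxx | apply: val_inj].
move=> p p'; rewrite !inE => /andP[_ /eqP pj] /andP[_ /eqP p'j] e.
apply: t_inj; rewrite [t p]surjective_pairing [t p']surjective_pairing e.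
by congr (_, _); apply: val_inj; rewrite /= pj p'j.
Qed.

(** In a given row, the entries to the left of [m] are exactly the entries smaller than [m]. Thus
    the rows of the entries determine the columns. *)
Lemma standard_col (m : 'I_n) : (t m).2 = sh t m (t m).1 :> nat.
Proof.
case/and4P: (std) => _ /injectiveP t_inj /forallP t_in _.
rewrite -[LHS](@standard_count (t m).1); last exact: ltnW.
rewrite /sh [LHS]big_mkcond [RHS]big_mkcond; apply: eq_bigr => p _.
have [/val_inj e|_] := eqVneq ((t p).1 : nat) (t m).1; last by rewrite !if_same.
have [lt|gt|e2] := ltngtP (t p).2 (t m).2.
- by rewrite (standard_row_lt e lt).
- by have := standard_row_lt (esym e) gt; case: ltngtP.
- rewrite (_ : p = m) ?ltnn //; apply: t_inj.
  by rewrite [t p]surjective_pairing [t m]surjective_pairing e (val_inj e2).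
Qed.

Lemma standard_shape j : j < k -> sh t n j = nth 0 lam j.
Proof.
move=> jk; case/and4P: (std) => _ _ /forallP t_in _.
rewrite -[RHS](@standard_count (Ordinal jk)) //.
rewrite /sh [LHS]big_mkcond [RHS]big_mkcond; apply: eq_bigr => p _.
rewrite ltn_ord /=; case: eqP => [<-|]; last by rewrite if_same.
by rewrite t_in.
Qed.

End Standard.

(** An admissible tableau amounts to a path of admissible shapes in which each entry is put at the
    end of its row; the later arguments use only this form. *)
Lemma mem_Atab k l n lam (t : tab k n) : 0 < k -> size lam = k ->
  (t \in Atab k (k + l) n lam) <->
  [/\ forall m : 'I_n, (t m).2 = sh t m (t m).1 :> nat,
      forall j, j < k -> sh t n j = nth 0 lam j &
      forall m, m <= n -> adm k l (sh t m)].
Proof.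
move=> k_gt0 sz; rewrite inE; split.
  case/andP => std /forallP adms; split.
  - by move=> m; apply: (standard_col sz std).
  - exact: (standard_shape sz std).
  move=> m mn; have /admissibleP[_] := adms (Ordinal (mn : m < n.+1)).
  by apply: eq_adm => // j _; rewrite nth_shape_at.
case=> col fin adms; apply/andP; split; last first.
  apply/forallP => m; apply/admissibleP; split; first exact: size_shape_at.
  have mn : m <= n by rewrite -ltnS.
  by apply: eq_adm (adms _ mn) => // j _; rewrite nth_shape_at.
apply/and4P; split.
- rewrite (sumn_nth sz) -[X in _ == X](sum_sh t (leqnn n)); apply/eqP/eq_bigr => j _.
  by rewrite fin.
- apply/injectiveP => p p' e.
  wlog lt : p p' e / p < p'.
    move=> W; have [lt|gt|/val_inj //] := ltngtP p p'; first exact: W.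
    exact/esym/W.
  by have := ltn_sh t lt; rewrite -col e -col ltnn.
- by apply/forallP => m; rewrite -fin // col; apply: ltn_sh.
- apply/forallP => m; apply/forallP => m'; apply/andP; split.
    apply/implyP => /andP[/eqP e /eqP]; rewrite !col -e => e2.
    by rewrite ltnNge; apply/negP => /(leq_sh t (t m).1); lia.
  apply/implyP => /andP[/eqP e /eqP e2].
  have [//|gt|/val_inj em] := ltngtP m m'; last by move: e2; rewrite em; lia.
  (* If the lower entry [m'] came first, then at time [m] row [(t m).1.+1] would be longer than row
     [(t m).1]. *)
  have := ltn_sh t gt; rewrite -col -e col e2.
  have [f1 _] := adms m (ltnW (ltn_ord m)).
  have := f1 (t m).1 (t m).1.+1 (leqnSn _); rewrite -e2 => /(_ (ltn_ord _)).
  by rewrite e2; lia.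
Qed.

(** * The conjugate diagram *)

Lemma divn_eqP d q x : q * d <= x < q.+1 * d -> x %/ d = q.
Proof.
case/andP=> le_qx lt_xq; have d_gt0 : 0 < d by case: d lt_xq {le_qx} => //; rewrite muln0.
by apply/eqP; rewrite eqn_leq leq_divRL // le_qx andbT -ltnS ltn_divLR.
Qed.

Lemma sum_ltn_ord k a : a <= k -> \sum_(j < k) (j < a : nat) = a.
Proof.
move=> ak; rewrite -[RHS](card_ord_lt ak) -sum1dep_card [RHS]big_mkcond.
by apply: eq_bigr => j _; case: ltnP.
Qed.

(** Both sides count the columns [c < x] congruent to [i] modulo [l]: one per full block of [l]
    columns, and one more if the last partial block reaches [i]. *)
Lemma tile_entry l x i : i < l -> (x + l - i.+1) %/ l = x %/ l + (i < x %% l).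
Proof.
move=> il; have l_gt0 : 0 < l by lia.
have := ltn_pmod x l_gt0; have := divn_eq x l.
move: (x %/ l) (x %% l) => q m -> ml; apply: divn_eqP; rewrite mulSn mulnDl.
by case: (ltnP i m) => im; rewrite ?mul1n ?mul0n; apply/andP; split; lia.
Qed.

Lemma tile_entryS l x i : i < l ->
  (x.+1 + l - i.+1) %/ l = (x + l - i.+1) %/ l + (x %% l == i).
Proof.
move=> il; rewrite (tile_entry x il); have l_gt0 : 0 < l by lia.
have := ltn_pmod x l_gt0; have := divn_eq x l.
move: (x %/ l) (x %% l) => q m -> ml; apply: divn_eqP; rewrite mulSn !mulnDl.
by case: (ltngtP i m) => im; rewrite ?mul1n ?mul0n ?addn0; apply/andP; split; lia.
Qed.

Definition rc (k l : nat) (f : nat -> nat) (i : nat) : nat :=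
  \sum_(j < k) (f j + l - i.+1) %/ l.

Lemma eq_rc k l f g i : (forall j, j < k -> f j = g j) -> rc k l f i = rc k l g i.
Proof. by move=> fg; apply: eq_bigr => j _; rewrite fg. Qed.

Lemma rc_eq0 k l f i : i < l -> (forall j, j < k -> f j = 0) -> rc k l f i = 0.
Proof.
move=> il f0; rewrite /rc big1 // => j _.
by rewrite f0 // tile_entry // div0n mod0n.
Qed.

(** The added box has column [f a], so the only tile entry of row [a] that grows is the one at the
    residue of [f a]. *)
Lemma rc_addbox k l f g a i : i < l -> a < k ->
    (forall j, j < k -> g j = f j + (a == j)) ->
  rc k l g i = rc k l f i + (f a %% l == i).
Proof.
move=> il ak gE; rewrite /rc (bigD1 (Ordinal ak)) //= [in RHS](bigD1 (Ordinal ak)) //=.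
rewrite gE // eqxx addn1 tile_entryS // addnAC; congr (_ + _ + _).
by apply: eq_bigr => j ja; rewrite gE // eq_sym (negPf (ja : _ != a :> nat)) addn0.
Qed.

(** The image of the added box lands at the end of its row. By admissibility of [f] and [g], rows
    above [a] have length from [f a + 1] to [f a + l] and contribute [f a %/ l + 1]; the other rows
    have length from [f a + 1 - l] to [f a] and contribute [f a %/ l]. *)
Lemma rc_col k l f g a : 0 < l -> a < k -> adm k l f -> adm k l g ->
    (forall j, j < k -> g j = f j + (a == j)) ->
  rc k l f (f a %% l) = k * (f a %/ l) + a.
Proof.
move=> l_gt0 ak [f1 f2] [g1 g2] gE.
(* The right-hand side becomes the sum over rows [j] of [f a %/ l + (j < a)], to be compared term by
   term. *)
rewrite -[X in _ = _ + X](sum_ltn_ord (ltnW ak)) -[X in X * _]card_ord -sum_nat_const -big_split /=.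
apply: eq_bigr => -[j jk] _ /=.
have := ltn_pmod (f a) l_gt0; have := divn_eq (f a) l.
move: (f a %/ l) (f a %% l) => q m fa ml; apply: divn_eqP; rewrite mulSn mulnDl.
have f0j := f1 0 j (leq0n _) jk; have fjk := f1 j k.-1.
have f0a := f1 0 a (leq0n _) ak; have fak := f1 a k.-1.
have gE0 := gE 0; have gEk := gE k.-1; have gEa := gE _ ak; have gEj := gE _ jk.
case: (ltnP j a) => ja.
  by have gja := g1 j a (ltnW ja) ak; rewrite mul1n; apply/andP; split; lia.
have [ej|nej] := eqVneq a j.
  by rewrite -ej fa mul0n addn0; apply/andP; split; lia.
have faj := f1 a j ja jk; have g0a := g1 0 a (leq0n _) ak.
by rewrite mul0n addn0; apply/andP; split; lia.
Qed.

(** Each row of the tile is weakly decreasing and drops by at most one in total; summing over the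
    [k] rows bounds the spread by [k]. *)
Lemma rc_adm k l f : 0 < l -> adm l k (rc k l f).
Proof.
move=> l_gt0; split.
  by move=> i j ij jl; apply: leq_sum => h _; rewrite leq_div2r //; lia.
rewrite -[X in _ + X]card_ord -sum1_card -big_split /=; apply: leq_sum => j _.
by rewrite !tile_entry //; lia.
Qed.

(** The box is taken from the last row as long as the first. Either the bottom row is untouched, or
    all rows were equal and the spread becomes at most one, hence at most [l]. *)
Lemma adm_rmbox k l f : 0 < l -> adm k l f -> 0 < \sum_(j < k) f j ->
  exists a g, [/\ a < k, adm k l g & forall j, j < k -> f j = g j + (a == j)].
Proof.
move=> l_gt0 [f1 f2] sum_gt0.
have k_gt0 : 0 < k by case: (k) sum_gt0 => //; rewrite big_ord0.
have f0_gt0 : 0 < f 0.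
  rewrite lt0n; apply/eqP => f0; move: sum_gt0; rewrite big1 // => j _.
  by have := f1 0 j (leq0n _) (ltn_ord j); lia.
have exP : exists a, (a < k) && (f a == f 0) by exists 0; rewrite k_gt0 eqxx.
have ubP a : (a < k) && (f a == f 0) -> a <= k by lia.
case: (ex_maxnP exP ubP) => a /andP[ak /eqP fa] amax.
exists a, (fun j => f j - (a == j)); split=> //; last first.
  by move=> j jk; case: eqP => [<-|] /=; lia.
split=> [i j ij jk|].
  have fij := f1 _ _ ij jk; have := amax j; have := f1 0 j (leq0n _) jk.
  by rewrite jk /=; case: (eqVneq a i) => ?; case: (eqVneq a j) => ?; subst=> /=; lia.
case: (eqVneq a k.-1) => [e|?]; last by lia.
by rewrite -e fa; lia.
Qed.

(** Induction on the number of boxes: a box added to row [a] gives a box in column [k * q + a] of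
    the conjugate, which in turn gives a box in row [(k * q + a) %% k = a]. *)
Lemma rc_involutive k l f j : 0 < k -> 0 < l -> adm k l f -> j < k ->
  rc l k (rc k l f) j = f j.
Proof.
move=> k_gt0 l_gt0; have [N] := ubnP (\sum_(j < k) f j).
elim: N => // N IH in f j *; rewrite ltnS => leN f_adm jk.
have [sum0|sum_gt0] := posnP (\sum_(j < k) f j).
  have f0 i : i < k -> f i = 0.
    by move=> ik; move: sum0; rewrite (bigD1 (Ordinal ik)) //=; lia.
  by rewrite f0 // rc_eq0 // => i il; rewrite rc_eq0.
have [a [g [ak g_adm gE]]] := adm_rmbox l_gt0 f_adm sum_gt0.
have b_lt : g a %% l < l by rewrite ltn_mod.
have step i : i < l -> rc k l f i = rc k l g i + (g a %% l == i).
  by move=> il; apply: rc_addbox.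
rewrite (rc_addbox jk b_lt step) (rc_col l_gt0 ak g_adm f_adm gE).
rewrite mulnC modnMDl modn_small // IH -?gE //.
apply: leq_trans leN; rewrite [X in _ < X](eq_bigr _ (fun i _ => gE _ (ltn_ord i))).
by rewrite big_split /= [X in _ < _ + X](bigD1 (Ordinal ak)) //= eqxx; lia.
Qed.

(** * The conjugate tableau *)

(** As [i < n.-1], the index [i.+1] is below [n] and the default of [insubd] is never reached. *)
Lemma val_hi n (i : 'I_n.-1) : hi i = i.+1 :> nat.
Proof. by rewrite /hi insubdK // -topredE /=; have := ltn_ord i; lia. Qed.

Lemma lo_neq_hi n (i : 'I_n.-1) : lo i != hi i.
Proof. by rewrite -val_eqE /= val_hi; lia. Qed.

Section Swap.
Variables (k n : nat).
Implicit Types (t : tab k n) (i : 'I_n.-1).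

Lemma swap_lo i t : swap_tab i t (lo i) = t (hi i).
Proof. by rewrite ffunE tpermL. Qed.

Lemma swap_hi i t : swap_tab i t (hi i) = t (lo i).
Proof. by rewrite ffunE tpermR. Qed.

Lemma swap_other i t m : lo i != m -> hi i != m -> swap_tab i t m = t m.
Proof. by move=> *; rewrite ffunE tpermD. Qed.

Lemma swapK i t : swap_tab i (swap_tab i t) = t.
Proof. by apply/ffunP => m; rewrite !ffunE tpermK. Qed.

(** The transposition preserves the set of entries below [m] unless [m] separates the two exchanged
    entries. *)
Lemma sh_swap i t m j : m != i.+1 -> sh (swap_tab i t) m j = sh t m j.
Proof.
move=> mi; rewrite /sh (reindex_inj (@perm_inj _ (tperm (lo i) (hi i)))) /=.
apply: eq_big => [p|p _]; last by rewrite ffunE tpermK.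
case: tpermP => [->|->|//]; rewrite val_hi /=; lia.
Qed.

Lemma sh_swapS i t j : sh (swap_tab i t) i.+1 j = sh t i j + ((t (hi i)).1 == j :> nat).
Proof. by rewrite (shS _ (lo i)) swap_lo /= sh_swap //; lia. Qed.

Lemma dcont_swap i t : dcont (swap_tab i t) i = (- dcont t i)%R.
Proof. by rewrite /dcont swap_lo swap_hi; lia. Qed.

End Swap.

(** * Axial distances and inadmissible swaps *)

Section Admissible.
Variables (k l n : nat) (lam : seq nat).
Hypotheses (k_gt0 : 0 < k) (l_gt0 : 0 < l) (sz : size lam = k).
Implicit Types (t : tab k n) (i : 'I_n.-1).

Lemma col_lo_hi t i : t \in Atab k (k + l) n lam ->
  (t (lo i)).2 = sh t i (t (lo i)).1 :> nat /\
  (t (hi i)).2 = sh t i (t (hi i)).1 + ((t (lo i)).1 == (t (hi i)).1) :> nat.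
Proof.
case/(mem_Atab _ _ k_gt0 sz) => col _ _; rewrite !col; split=> //.
by rewrite val_hi (shS _ (lo i)).
Qed.

(** Contents at row ends strictly decrease down the shape, over at most [k - 1] rows and a spread of
    lengths at most [l]. This keeps [[d]] nonzero. *)
Lemma dcont_bounds t i : t \in Atab k (k + l) n lam -> 0 < `|dcont t i| < k + l.
Proof.
move=> tA; have [c1 c2] := col_lo_hi i tA.
case/(mem_Atab _ _ k_gt0 sz): tA => _ _ adms.
have [] : adm k l (sh t i) by apply: adms; have := ltn_ord i; lia.
rewrite /dcont c1 c2 -val_eqE /=.
move: (t (lo i)).1 (t (hi i)).1 => -[a ak] [b bk] /= f1 f2.
have [<-|ne] := eqVneq a b; first by lia.
have fa := f1 0 a (leq0n _) ak; have fb := f1 0 b (leq0n _) bk.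
have fak := f1 a k.-1; have fbk := f1 b k.-1.
have fab := f1 a b; have fba := f1 b a.
by lia.
Qed.

(** Adding [b] before [a] fails in two ways: the box of [b] lies directly below that of [a], or [b]
    is the first row, [a] the last, and the spread is already [l]. The last two alternatives record
    these through contents. *)
Lemma adm_swap (f : nat -> nat) a b : a < k -> b < k -> a != b ->
    adm k l f -> adm k l (fun j => f j + (a == j) + (b == j)) ->
  [\/ adm k l (fun j => f j + (b == j)), f a + b = f b + a + 1 |
      f a + b + (k + l) = f b + a + 1].
Proof.
move=> ak bk ab [f1 f2] [h1 h2].
have [e1|n1] := eqVneq (f a + b) (f b + a + 1); first exact: Or32.
have [e2|n2] := eqVneq (f a + b + (k + l)) (f b + a + 1); first exact: Or33.
apply: Or31; split=> [i j ij jk|].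
  have fij := f1 _ _ ij jk.
  have [ebj|nbj] := eqVneq b j; last by rewrite addn0 (leq_trans fij) ?leq_addr.
  subst j; have [<-//|nbi] := eqVneq b i.
  have := h1 _ _ ij jk; rewrite eqxx (negPf ab) (negPf nbi) !addn0.
  have [eai|nai] := eqVneq a i; last by rewrite addn0.
  subst i; move=> _; rewrite addn1 ltn_neqAle fij andbT; apply/eqP => fba.
  have ltab : a < b by rewrite ltn_neqAle ab.
  (* If [b] does not directly follow [a], row [b.-1] must be strictly longer than row [b], yet it is
     at most [f a = f b]. *)
  have [e|ne] := eqVneq a b.-1.
    by case/eqP: n1; rewrite fba; clear -e ltab; lia.
  have := h1 _ _ (leq_pred b) bk; rewrite eqxx (negPf ab) (negPf ne) addn0.
  have -> : (b == b.-1) = false by clear -ltab; lia.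
  have := f1 a b.-1; clear -fba ltab ne bk; lia.
(* The spread can grow only if the new box is in the first row. *)
have [eb|nb] := eqVneq b 0; last by rewrite addn0 (leq_trans f2) // leq_add2r leq_addr.
subst b; have [ek|nk] := eqVneq 0 k.-1; first by rewrite -ek; clear; lia.
move: h2; rewrite eqxx (negPf ab) (negPf nk) !addn0.
have [ea|na] := eqVneq a k.-1; last by rewrite addn0.
rewrite -ea in f2 *; clear -ea n2 f2 ak; lia.
Qed.

(** The exceptional distances come from two entries in one row, in one column, or at the width
    bound; at each of them [alpha] is 0 or 1. *)
Lemma swap_Atab t i : t \in Atab k (k + l) n lam ->
  [\/ swap_tab i t \in Atab k (k + l) n lam, dcont t i = -1, dcont t i = 1 |
      dcont t i = 1 - (k + l)%:Z]%R.
Proof.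
move=> tA; have [c1 c2] := col_lo_hi i tA.
case/(mem_Atab _ _ k_gt0 sz): (tA) => col fin adms.
have in1 : i.+1 < n by have := ltn_ord i; lia.
have f_adm : adm k l (sh t i) by apply: adms; lia.
have h_adm : adm k l (fun j => sh t i j + ((t (lo i)).1 == j :> nat) + ((t (hi i)).1 == j :> nat)).
  apply: eq_adm (adms i.+2 in1) => // j _.
  by rewrite -(val_hi i) shS val_hi (shS _ (lo i)).
have [e|ne] := eqVneq ((t (lo i)).1 : nat) (t (hi i)).1.
  by apply: Or42; rewrite /dcont c1 c2 -val_eqE /= e eqxx; lia.
have [g_adm|e|e] := adm_swap (ltn_ord _) (ltn_ord _) ne f_adm h_adm.
- apply: Or41; apply/mem_Atab => //; split.
  + move=> m; have [<-|nl] := eqVneq (lo i) m.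
      by rewrite swap_lo sh_swap ?c2 /= -?val_eqE /= ?(negPf ne) ?addn0 //; lia.
    have [<-|nh] := eqVneq (hi i) m.
      by rewrite swap_hi val_hi sh_swapS c1 eq_sym (negPf ne) addn0.
    rewrite swap_other // sh_swap ?col //.
    by move: nh; rewrite -val_eqE /= val_hi eq_sym.
  + by move=> j jk; rewrite sh_swap ?fin //; lia.
  + move=> m mn; have [->|nm] := eqVneq m i.+1.
      by apply: eq_adm g_adm => // j _; rewrite sh_swapS.
    by apply: eq_adm (adms m mn) => // j _; rewrite sh_swap.
- by apply: Or43; rewrite /dcont c1 c2 -val_eqE /= (negPf ne); lia.
- by apply: Or44; rewrite /dcont c1 c2 -val_eqE /= (negPf ne); lia.
Qed.

End Admissible.

(** * Conjugating boxes and tableaux *)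

Section Conj.
Variables (k l n : nat).
Hypothesis l_gt0 : 0 < l.

(* For an admissible tableau the new column is [< n], so [insubd] never falls
   back on its default. *)
Definition conj_box (b : 'I_k * 'I_n) : 'I_l * 'I_n :=
  (Ordinal (ltn_pmod b.2 l_gt0), insubd b.2 (k * (b.2 %/ l) + b.1)).

Definition conj_tab (t : tab k n) : tab l n := [ffun m => conj_box (t m)].

Lemma conj_tab_swap i t : conj_tab (swap_tab i t) = swap_tab i (conj_tab t).
Proof. by apply/ffunP => m; rewrite !ffunE. Qed.

Lemma conj_tab_row t m : (conj_tab t m).1 = (t m).2 %% l :> nat.
Proof. by rewrite ffunE. Qed.

Variable lam : seq nat.
Hypotheses (k_gt0 : 0 < k) (sz : size lam = k).

Section Fixed.
Variable t : tab k n.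
Hypothesis tA : t \in Atab k (k + l) n lam.

Lemma sh_conj m i : m <= n -> i < l -> sh (conj_tab t) m i = rc k l (sh t m) i.
Proof.
case/(mem_Atab _ _ k_gt0 sz): tA => col _ _.
elim: m => [|m IH] mn il; first by rewrite sh0 rc_eq0 // => j _; rewrite sh0.
rewrite (shS _ (Ordinal mn)) /= IH ?(ltnW mn) // conj_tab_row col.
rewrite (@rc_addbox _ _ (sh t m) (sh t m.+1) (t (Ordinal mn)).1) // => j _.
by rewrite (shS _ (Ordinal mn)).
Qed.

(** By [rc_col], the prescribed column is the current length of the row that receives the box. *)
Lemma conj_tab_col_sh m :
  k * ((t m).2 %/ l) + (t m).1 = sh (conj_tab t) m (conj_tab t m).1.
Proof.
case/(mem_Atab _ _ k_gt0 sz): tA => col _ adms.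
rewrite sh_conj ?(ltnW (ltn_ord m)) // conj_tab_row col.
have gE j : j < k -> sh t m.+1 j = sh t m j + ((t m).1 == j :> nat) by rewrite shS.
by rewrite (rc_col l_gt0 (ltn_ord _) (adms _ (ltnW (ltn_ord m))) (adms _ (ltn_ord m)) gE).
Qed.

(** That row length is at most the number [m] of boxes already placed, hence below [n], which makes
    [insubd] return the intended column. *)
Lemma conj_tab_col m : (conj_tab t m).2 = k * ((t m).2 %/ l) + (t m).1 :> nat.
Proof.
rewrite [in LHS]ffunE /= insubdK // -topredE /= conj_tab_col_sh.
apply: leq_ltn_trans (ltn_ord m).
rewrite -[X in _ <= X](sum_sh (conj_tab t) (ltnW (ltn_ord m))).
by rewrite (bigD1 (conj_tab t m).1) //= leq_addr.
Qed.

Lemma conj_tab_Atab lam' : size lam' = l ->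
    (forall i, i < l -> nth 0 lam' i = rc k l (nth 0 lam) i) ->
  conj_tab t \in Atab l (l + k) n lam'.
Proof.
move=> sz' lamE; case/(mem_Atab _ _ k_gt0 sz): (tA) => col fin adms.
apply/mem_Atab => //; split.
- by move=> m; rewrite conj_tab_col conj_tab_col_sh.
- by move=> i il; rewrite sh_conj // lamE //; apply: eq_rc.
- move=> m mn; apply: eq_adm (rc_adm k (sh t m) l_gt0) => // j jl.
  by rewrite sh_conj.
Qed.

Lemma dcont_conj i : exists z : int,
  (dcont (conj_tab t) i = - dcont t i + (k + l)%:Z * z)%R.
Proof.
(* The contents of a box and of its image sum to [k + l] times the block index of the column; [z] is
   the difference of the two block indices. *)
exists (((t (lo i)).2 %/ l)%:Z - ((t (hi i)).2 %/ l)%:Z)%R.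
rewrite /dcont !conj_tab_col !conj_tab_row.
have := divn_eq (t (lo i)).2 l; have := divn_eq (t (hi i)).2 l.
by nia.
Qed.

End Fixed.
End Conj.

Lemma conj_tabK k l n (k_gt0 : 0 < k) (l_gt0 : 0 < l) lam (t : tab k n) :
  size lam = k -> t \in Atab k (k + l) n lam ->
  conj_tab k_gt0 (conj_tab l_gt0 t) = t.
Proof.
move=> sz tA; apply/ffunP => m.
have c := conj_tab_col l_gt0 k_gt0 sz tA m; have r := conj_tab_row l_gt0 t m.
rewrite [LHS]surjective_pairing [RHS]surjective_pairing; congr (_, _); apply: val_inj => /=.
  by rewrite conj_tab_row c mulnC modnMDl modn_small.
rewrite [in LHS]ffunE /= c r [k * _]mulnC divnMDl // (divn_small (ltn_ord _)) addn0.
by rewrite mulnC -divn_eq insubdK // -topredE /=.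
Qed.

Local Open Scope ring_scope.

(** * Roots of -1 and quantum integers *)

Lemma rect_mul_sqr (R : comNzRingType) (i a b c d : R) :
    i * i = -1 -> a ^+ 2 + b ^+ 2 = 1 ->
  (c + i * d) * (a + i * b) ^+ 2 =
    c - 2%:R * b * (a * d + b * c) + i * (d + 2%:R * b * (a * c - b * d)).
Proof.
move=> ii ab1.
have a2 : a * a = 1 - b ^+ 2 by rewrite -ab1 addrK.
by ring: ii a2.
Qed.

Lemma Re_mul_sqr (y s : algC) : `|s| = 1 ->
  'Re (y * s ^+ 2) = 'Re y - 2%:R * 'Im s * ('Re s * 'Im y + 'Im s * 'Re y).
Proof.
move=> s1; have := normC2_Re_Im s; rewrite s1 expr1n => ab1.
have ii : 'i * 'i = -1 :> algC by rewrite -expr2 sqrCi.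
move: (Creal_Re y) (Creal_Im y) (Creal_Re s) (Creal_Im s) ab1 => rc rd ra rb ab1.
rewrite {1}(Crect y) {1}(Crect s).
set c := 'Re y in rc *; set d := 'Im y in rd *.
set a := 'Re s in ra ab1 *; set b := 'Im s in rb ab1 *.
rewrite (rect_mul_sqr _ _ ii (esym ab1)).
by rewrite Re_rect // ?(realB, realD, realM, realn).
Qed.

(** If no rotation by plus or minus twice the angle of [s] moves [y] to the right, then [y] is
    within that angle of 1. The hypotheses say that [b * c + a * d] and [b * c - a * d] are
    nonnegative: their sum gives [c >= 0], their product [a ^+ 2 <= c ^+ 2]. *)
Lemma Re_ge_of_rot_le (y s : algC) : `|y| = 1 -> `|s| = 1 -> 0 < 'Im s ->
  'Re (y * s ^+ 2) <= 'Re y -> 'Re (y * s^* ^+ 2) <= 'Re y -> 'Re s <= 'Re y.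
Proof.
move=> y1 s1 b_gt0; have := normC2_Re_Im s; have := normC2_Re_Im y.
rewrite y1 s1 expr1n => cd1 ab1.
rewrite !Re_mul_sqr ?norm_conjC // Re_conj Im_conj.
have rc := Creal_Re y; have rd := Creal_Im y; have ra := Creal_Re s.
set c := 'Re y in cd1 rc *; set d := 'Im y in cd1 rd *.
set a := 'Re s in ab1 ra *; set b := 'Im s in ab1 b_gt0 *.
rewrite gerBl pmulr_rge0; last by rewrite mulr_gt0 ?ltr0n.
rewrite gerBl mulrN mulNr -mulrN pmulr_rge0; last by rewrite mulr_gt0 ?ltr0n.
rewrite mulNr opprB => h1 h2.
have c_ge0 : 0 <= c.
  have : 0 <= (a * d + b * c) + (b * c - a * d) by rewrite addr_ge0.
  by rewrite (_ : _ + _ = 2%:R * b * c); [rewrite pmulr_rge0 ?mulr_gt0 ?ltr0n|ring].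
have le_ac2 : a ^+ 2 <= c ^+ 2.
  rewrite -subr_ge0; have : 0 <= (a * d + b * c) * (b * c - a * d) by rewrite mulr_ge0.
  have -> : (a * d + b * c) * (b * c - a * d) = b ^+ 2 * c ^+ 2 - a ^+ 2 * d ^+ 2 by ring.
  have -> : b ^+ 2 = 1 - a ^+ 2 by rewrite ab1 addrC addKr.
  have -> : d ^+ 2 = 1 - c ^+ 2 by rewrite cd1 addrC addKr.
  by congr (0 <= _); ring.
have [a_ge0|a_lt0] := real_ge0P ra; last by apply: ltW; apply: lt_le_trans c_ge0.
by rewrite -(ler_pXn2r (n := 2)) // nnegrE.
Qed.

Lemma prim_root_exp_half (r : nat) (s : algC) :
  (0 < r)%N -> (r + r).-primitive_root s -> s ^+ r = -1.
Proof.
move=> r_gt0 s_prim; have := prim_expr_order s_prim.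
rewrite addnn -mul2n mulnC exprM => /eqP.
rewrite sqrf_eq1 -(prim_order_dvd s_prim) => /orP[/dvdn_leq|/eqP //].
by move=> /(_ r_gt0); lia.
Qed.

(* [r.-root (-1)] is only known to maximize the real part among the roots of [-1].
   Take a primitive [z] and the element [y] of largest real part in its orbit under
   rotation by [s ^+ 2]: then [Re y >= Re s], so [y] is [s] or its conjugate, and [z]
   is a power of [s]. *)
Lemma rootCN1_prim (r : nat) : (1 < r)%N ->
  (r + r).-primitive_root (r.-root (-1) : algC).
Proof.
move=> r_gt1; have r_gt0 : (0 < r)%N by apply: ltnW.
set s : algC := r.-root (-1).
have sr : s ^+ r = -1 by rewrite rootCK.
have norm1 x : x ^+ r = -1 -> `|x| = 1 :> algC.
  by move=> xr; apply/eqP; rewrite -(@pexpr_eq1 _ _ r) // -normrX xr normrN1.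
have s1 := norm1 _ sr.
have sV : s^* = s^-1 by rewrite invC_norm s1 expr1n invr1 mul1r.
have conjr x : x ^+ r = -1 -> x^* ^+ r = -1 :> algC.
  by move=> xr; rewrite -rmorphXn xr rmorphN1.
have Re_max x : x ^+ r = -1 -> 'Re x <= 'Re s.
  move=> xr; have [x_ge0|x_lt0] := real_ge0P (Creal_Im x).
    by apply: rootC_Re_max.
  rewrite -Re_conj; apply: rootC_Re_max => //; first exact: conjr.
  by rewrite Im_conj oppr_ge0 ltW.
have Im_gt0 : 0 < 'Im s.
  rewrite lt_def Im_rootC_ge0 // andbT; apply/negP => /eqP/Creal_ImP.
  by rewrite realE rootC_ge0 // rootC_le0 // oppr_eq0 oner_eq0 orbF oppr_ge0 ler10.
have [z z_prim] := @C_prim_root_exists (r + r) (ltn_addr _ r_gt0).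
have zr := prim_root_exp_half r_gt0 z_prim.
have rr_gt0 : (0 < r + r)%N by rewrite addn_gt0 r_gt0.
pose F (j : 'I_(r + r)) := 'Re (z * s ^+ 2 ^+ j).
have [j _ jmax] := @real_arg_maxP _ _ (Ordinal rr_gt0) predT F isT (fun i _ => Creal_Re _).
set y := z * s ^+ 2 ^+ j.
have s2r : s ^+ 2 ^+ (r + r) = 1 by rewrite exprAC exprD sr mulrNN mulr1 expr1n.
have Fmod m : 'Re (z * s ^+ 2 ^+ m) <= 'Re y.
  have mlt : (m %% (r + r) < r + r)%N by rewrite ltn_mod.
  by rewrite -(expr_mod _ s2r); exact: (jmax (Ordinal mlt)).
have yr : y ^+ r = -1.
  rewrite exprMn zr -!exprM -mulnA mulnC -mulnA mulnC exprM.
  by rewrite [s ^+ (_ * _)]exprM sr sqrrN !expr1n mulr1.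
have y1 := norm1 _ yr.
have Re_y : 'Re y = 'Re s.
  apply/le_anti; rewrite Re_max //=; apply: (Re_ge_of_rot_le y1 s1 Im_gt0).
    by rewrite /y -mulrA -exprSr; apply: Fmod.
  (* The inverse rotation is the forward one iterated [(r + r).-1] times. *)
  rewrite (_ : y * _ = z * s ^+ 2 ^+ (j + (r + r).-1)) ?Fmod //.
  rewrite /y -mulrA; congr (_ * _); rewrite exprD; congr (_ * _).
  rewrite sV exprVn -[LHS]mul1r -s2r -{1}(prednK rr_gt0) exprSr mulfK //.
  by rewrite expf_neq0 // -normr_eq0 s1 oner_eq0.
have Im_y : 'Im y = 'Im s \/ 'Im y = - 'Im s.
  have : 'Im y ^+ 2 = 'Im s ^+ 2.
    have := normC2_Re_Im s; have := normC2_Re_Im y.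
    by rewrite y1 s1 Re_y => -> /addrI.
  by move/eqP; rewrite eqf_sqr => /orP[]/eqP; [left|right].
have y_s : y = s \/ y = s^*.
  case: Im_y => Im_y; [left|right]; rewrite [LHS]Crect Re_y Im_y; first by rewrite -Crect.
  by rewrite [RHS]Crect Re_conj Im_conj.
have [i z_s] : exists i, z = s ^+ i.
  have sU : s != 0 by rewrite -normr_eq0 s1 oner_eq0.
  have s2V : s ^+ 2 ^+ j * s ^+ 2 ^+ (r + r - j) = 1 by rewrite -exprD subnKC // ltnW.
  have -> : z = y * s ^+ 2 ^+ (r + r - j) by rewrite /y -mulrA s2V mulr1.
  case: y_s => ->; first by exists (2 * (r + r - j)).+1%N; rewrite [RHS]exprS [in RHS]exprM.
  exists (2 * (r + r - j) + (r + r).-1)%N; rewrite sV exprD exprM mulrC; congr (_ * _).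
  by apply: (mulfI sU); rewrite mulfV // -exprS prednK // exprD sr mulrNN mulr1.
have srr : s ^+ (r + r) = 1 by rewrite exprD sr mulrNN mulr1.
have [m s_prim m_dvd] := prim_order_exists rr_gt0 srr.
(* As [z] is a power of [s], its order [r + r] divides the order [m] of [s]. *)
suff -> : (r + r = m)%N by [].
apply/eqP; rewrite eqn_dvd m_dvd andbT (prim_order_dvd z_prim).
by rewrite z_s exprAC (prim_expr_order s_prim) expr1n.
Qed.

(** The coefficient [alpha] as a function of the axial distance alone. *)
Definition qratio (s : algC) (d : int) : algC := qint s (d + 1) / (qint s 2 * qint s d).

Lemma qintN (s : algC) m : qint s (- m) = - qint s m.
Proof. by rewrite /qint opprK -opprB mulNr. Qed.

(** * Quantum integers at a primitive root of order [r + r] *)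

Section Roots.
Variables (r : nat) (s : algC).
Hypothesis r_gt1 : (1 < r)%N.
Hypothesis s_prim : (r + r).-primitive_root s.

Let s_neq0 : s != 0.
Proof. by rewrite (prim_root_eq0 s_prim); lia. Qed.

(** Vanishing would mean [s ^ (2 m) = 1], although [2 m] lies strictly between 0 and the order of
    [s] up to sign. *)
Lemma exprz_sub_inv_neq0 (m : int) : (0 < `|m| < r)%N -> s ^ m - s ^ (- m) != 0.
Proof.
have nat_case (n : nat) : (0 < n < r)%N -> s ^ n - s ^ (- n%:Z) != 0.
  move=> n_r; rewrite subr_eq0 -invr_expz; apply/eqP => /(congr1 ( *%R (s ^ n))).
  rewrite mulfV ?expfz_neq0 // -exprD => /eqP; rewrite -(prim_order_dvd s_prim).
  by move/dvdn_leq; lia.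
case: m => n n_r; first exact: nat_case.
by rewrite NegzE opprK -opprB oppr_eq0; apply: nat_case; lia.
Qed.

Lemma qint_neq0 (m : int) : (0 < `|m| < r)%N -> qint s m != 0.
Proof.
move=> m_r; rewrite mulf_neq0 ?invr_eq0 ?exprz_sub_inv_neq0 //.
by have := @exprz_sub_inv_neq0 1; rewrite exprN1 expr1z; apply; lia.
Qed.

Lemma qint_period (m z : int) : qint s (m + r%:Z * z) = (-1) ^ z * qint s m.
Proof.
have e1 : (-1) ^ z * (-1) ^ z = 1 :> algC.
  by rewrite -expfzMl mulrNN mulr1 exp1rz.
have eV : (-1) ^ (- z) = (-1) ^ z :> algC.
  by rewrite -invr_expz; apply: (mulfI (expfz_neq0 z (_ : -1 != 0)));
     rewrite ?mulfV ?expfz_neq0 ?oppr_eq0 ?oner_eq0.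
rewrite /qint opprD !expfzDr // -[- (_ * z)]mulrN -!exprz_exp -exprnP.
rewrite (prim_root_exp_half _ s_prim) 1?ltnW // eV; ring.
Qed.

(** The signs [(-1) ^ z] of numerator and denominator cancel. *)
Lemma qratio_period (m z : int) : qratio s (m + r%:Z * z) = qratio s m.
Proof.
rewrite /qratio addrAC !qint_period [qint s 2 * _]mulrCA -mulf_div.
rewrite mulfV ?mul1r //.
by rewrite expfz_neq0 // oppr_eq0 oner_eq0.
Qed.

Lemma qint2_mul (m : int) : qint s 2 * qint s m = qint s (m + 1) + qint s (m - 1).
Proof.
have s1 : s - s^-1 != 0.
  by have := @exprz_sub_inv_neq0 1; rewrite exprN1 expr1z; apply; lia.
have -> : qint s 2 = s + s^-1.
  rewrite /qint -invr_expz -exprnP expr2 invfM.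
  by rewrite (_ : s * s - s^-1 * s^-1 = (s + s^-1) * (s - s^-1)) ?mulfK //; ring.
rewrite /qint mulrA -mulrDl; congr (_ / _).
rewrite !opprD opprK !expfzDr // exprN1 expr1z; ring.
Qed.

(** The two ratios have numerators [[m - 1]] and [[m + 1]] over [[2][m]], and [[2][m] = [m + 1] +
    [m - 1]]. *)
Lemma qratioN (m : int) : (2 < r)%N -> (0 < `|m| < r)%N ->
  qratio s (- m) = 1 - qratio s m.
Proof.
move=> r_gt2 m_r; have m0 := qint_neq0 m_r.
have q20 : qint s 2 != 0 by apply: qint_neq0; lia.
rewrite /qratio !qintN (_ : - m + 1 = - (m - 1)) ?qintN; last by rewrite opprD opprK.
rewrite mulrN invrN mulrNN; apply/esym/(canLR (addrK _)).
by rewrite -mulrDl addrC -qint2_mul divff // mulf_neq0.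
Qed.

Lemma qratio1 : (2 < r)%N -> qratio s 1 = 1.
Proof.
move=> r_gt2; rewrite /qratio (_ : qint s 1 = 1).
  by rewrite mulr1 divff //; apply: qint_neq0; lia.
rewrite /qint divff //; exact: (@exprz_sub_inv_neq0 1).
Qed.

Lemma qratioN1 : qratio s (-1) = 0.
Proof. by rewrite /qratio addNr /qint oppr0 subrr !mul0r. Qed.

End Roots.

(** * The intertwiner *)

(* Any function of [t] that is alternating and nonzero would do: it gauges away the
   sign by which the off-diagonal entries of [1 - E_i] differ from those of the
   conjugate [E_i]. *)
Definition alt_weight k n (t : tab k n) : algC :=
  \det (Vandermonde n (\row_m ((t m).1 * n + (t m).2)%N%:R)).

(** The swap exchanges two columns of the Vandermonde matrix. *)
Lemma alt_weight_swap k n i (t : tab k n) : alt_weight (swap_tab i t) = - alt_weight t.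
Proof.
rewrite /alt_weight; set V := Vandermonde n _; set W := Vandermonde n _.
have -> : V = xcol (lo i) (hi i) W by apply/matrixP => a b; rewrite !mxE ffunE.
by rewrite xcolE det_mulmx det_perm odd_tperm lo_neq_hi expr1 mulrN1.
Qed.

(** Columns are below [n], so the node [row * n + column] determines the box; distinct boxes give
    distinct nodes. *)
Lemma alt_weight_neq0 k n (t : tab k n) : injective t -> alt_weight t != 0.
Proof.
move=> t_inj; rewrite /alt_weight det_Vandermonde.
apply/prodf_neq0 => a _; apply/prodf_neq0 => b ab.
rewrite !mxE subr_eq0 eqr_nat; apply/eqP => e.
suff /t_inj eab : t b = t a by move: ab; rewrite eab ltnn.
have n_gt0 : (0 < n)%N by have := ltn_ord a; lia.
rewrite [LHS]surjective_pairing [RHS]surjective_pairing; congr (_, _); apply: val_inj => /=.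
  have := congr1 (divn^~ n) e.
  by rewrite !divnMDl // !(divn_small (ltn_ord (t _).2)) !addn0.
have := congr1 (modn^~ n) e.
by rewrite !modnMDl !(modn_small (ltn_ord (t _).2)).
Qed.

Lemma Atab_inj k r n lam (t : tab k n) : t \in Atab k r n lam -> injective t.
Proof. by rewrite inE => /andP[/and4P[_ /injectiveP]]. Qed.

(** Reduces the equivalence to the positive generators: inverting the relation handles the inverse
    letters, and induction handles words. *)
Lemma twisted_dual_intertwine n d1 d2 (s : algC) (M1 : 'I_n.-1 -> 'M[algC]_d1)
    (M2 : 'I_n.-1 -> 'M[algC]_d2) (P : 'M_(d1, d2)) (Q : 'M_(d2, d1)) :
    s != 0 -> P *m Q = 1%:M -> Q *m P = 1%:M ->
    (forall i, M2 i \in unitmx) ->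
    (forall i, P *m (- s ^+ 2 *: (invmx (M2 i))^T) = M1 i *m P) ->
  forall w, P *m twisted_dual s (word_eval M2) w = word_eval M1 w *m P.
Proof.
move=> s0 PQ QP M2u inter.
have c0 : - s ^+ 2 != 0 by rewrite oppr_eq0 expf_neq0.
have inter' i : P *m ((- s ^+ 2)^-1 *: (M2 i)^T) = invmx (M1 i) *m P.
  set N := _ *: _.
  have BN : (- s ^+ 2 *: (invmx (M2 i))^T) *m N = 1%:M.
    rewrite -scalemxAl -scalemxAr scalerA mulfV // scale1r -trmx_mul.
    by rewrite mulmxV // trmx1.
  have M1N : M1 i *m (P *m N) = P by rewrite mulmxA -inter -mulmxA BN mulmx1.
  have M1u : M1 i \in unitmx.
    by have /mulmx1_unit[] : M1 i *m (P *m N *m Q) = 1%:M by rewrite mulmxA M1N.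
  by rewrite -{2}M1N mulKmx.
have unit_eval w : word_eval M2 w \in unitmx.
  elim: w => [|x w IH] /=; first exact: unitmx1.
  by rewrite unitmx_mul IH andbT; case: ifP; rewrite ?unitmx_inv.
elim=> [|x w IH].
  by rewrite /twisted_dual /chi big_nil /= invmx1 trmx1 scale1r mulmx1 mul1mx.
pose X := if x.2 then M2 x.1 else invmx (M2 x.1).
have Xu : X \in unitmx by rewrite /X; case: ifP; rewrite ?unitmx_inv.
(* Inversion and transposition both reverse products, so the twisted dual is multiplicative. *)
have -> : twisted_dual s (word_eval M2) (x :: w) =
    ((if x.2 then - s ^+ 2 else (- s ^+ 2)^-1) *: (invmx X)^T) *m
    twisted_dual s (word_eval M2) w.
  rewrite /twisted_dual /chi big_cons /= -/X -scalemxAl -scalemxAr scalerA -trmx_mul.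
  congr (_ *: _^T).
  have Wu := unit_eval w; have XWu : X *m word_eval M2 w \in unitmx by rewrite unitmx_mul Xu.
  apply: (can_inj (mulKmx XWu)); rewrite mulmxV // -mulmxA (mulmxA (word_eval M2 w)).
  by rewrite mulmxV // mul1mx mulmxV.
rewrite /= -[RHS]mulmxA -IH !mulmxA; congr (_ *m _).
by rewrite /X; case: x.2; rewrite ?invmxK.
Qed.

(** The matrix acts as [q] on the kernel of [E] and as -1 on its image; its inverse has the same
    form with [q^-1] for [q]. *)
Lemma two_eigenvalue_inv (F : fieldType) d (q : F) (E : 'M_d) : q != 0 -> E *m E = E ->
  (q%:M - (1 + q) *: E) *m (q^-1%:M - (1 + q^-1) *: E) = 1%:M.
Proof.
move=> q0 EE; rewrite mulmxBl !mulmxBr !mul_scalar_mx mul_mx_scalar -!scalemxAl -!scalemxAr.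
rewrite EE scale_scalar_mx mulfV // !scalerA.
have -> : (1 + q) * (1 + q^-1) = q * (1 + q^-1) + q^-1 * (1 + q).
  by field.
by rewrite scalerDl opprB addrK subrK.
Qed.

(** * The matrices [E_i] and their conjugates *)

Section Matrices.
Variables (k l n : nat) (s : algC) (lam : seq nat).
Hypotheses (k_gt0 : (0 < k)%N) (l_gt0 : (0 < l)%N) (r_gt2 : (2 < k + l)%N).
Hypothesis s_prim : ((k + l) + (k + l)).-primitive_root s.
Hypothesis sz : size lam = k.
Local Notation A := (Atab k (k + l) n lam).
Implicit Types (t x y : tab k n) (i : 'I_n.-1).

Let r_gt1 : (1 < k + l)%N := ltnW r_gt2.

Lemma alpha_swap t i : t \in A -> alpha s (swap_tab i t) i = 1 - alpha s t i.
Proof.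
move=> tA; rewrite -![alpha _ _ _]/(qratio _ _) dcont_swap.
by rewrite (qratioN r_gt1 s_prim) // (dcont_bounds k_gt0 l_gt0 sz).
Qed.

Lemma beta_swap t i : t \in A -> beta s (swap_tab i t) i = beta s t i.
Proof. by move=> tA; rewrite /beta alpha_swap // subKr mulrC. Qed.

Lemma alpha_idem t i : t \in A -> swap_tab i t \notin A ->
  alpha s t i * alpha s t i = alpha s t i.
Proof.
move=> tA stA; rewrite -![alpha _ _ _]/(qratio _ _).
case: (swap_Atab k_gt0 l_gt0 sz i tA) => [|->|->|->]; first by rewrite (negPf stA).
- by rewrite qratioN1 mulr0.
- by rewrite (qratio1 r_gt1 s_prim) // mulr1.
- by rewrite -mulrN1 (qratio_period r_gt1 s_prim) (qratio1 r_gt1 s_prim) // mulr1.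
Qed.

Lemma beta_sqr t i : beta s t i * beta s t i = alpha s t i - alpha s t i * alpha s t i.
Proof. by rewrite -expr2 sqrtCK mulrBr mulr1. Qed.

(** Entries indexed by tableaux instead of ordinals, so that matrix products become sums over
    [A]. *)
Definition E_entry i x y : algC :=
  (if x == y then alpha s y i else 0) +
  (if (x == swap_tab i y) && (swap_tab i y \in A) then beta s y i else 0).

Lemma sum_E_entry (g : tab k n -> algC) i y : y \in A ->
  \sum_(z in A) g z * E_entry i z y =
  g y * alpha s y i + (if swap_tab i y \in A then g (swap_tab i y) * beta s y i else 0).
Proof.
move=> yA; under eq_bigr do rewrite mulrDr; rewrite big_split /=; congr (_ + _).
  rewrite (bigD1 y) //= eqxx big1 ?addr0 // => z /andP[_ /negPf ->].
  exact: mulr0.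
case: ifP => syA; last by rewrite big1 // => z _; rewrite andbF mulr0.
rewrite (bigD1 (swap_tab i y)) //= eqxx big1 ?addr0 // => z /andP[_ /negPf ->].
exact: mulr0.
Qed.

Lemma swap_neq i t : t \in A -> (swap_tab i t == t) = false.
Proof.
move/Atab_inj => t_inj; apply/eqP => /(congr1 (fun u : tab k n => u (lo i))).
by rewrite swap_lo => /t_inj/esym/eqP; rewrite (negPf (lo_neq_hi i)).
Qed.

(** On the span of [t] and its swap, [E_i] has diagonal [alpha], [1 - alpha] and off-diagonal
    [beta], with [beta ^+ 2 = alpha * (1 - alpha)]. If the swap is not admissible, the block is the
    scalar [alpha], equal to 0 or 1. *)
Lemma Emx_idem i : Emx s k (k + l) lam i *m Emx s k (k + l) lam i = Emx s k (k + l) lam i.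
Proof.
apply/matrixP => a b; rewrite !mxE -/(E_entry i (enum_val a) (enum_val b)).
under eq_bigr do rewrite !mxE -/(E_entry i _ _) -/(E_entry i _ _).
have yA := enum_valP b; have xA := enum_valP a.
move: (enum_val a) (enum_val b) xA yA => x y xA yA.
rewrite -(big_enum_val (fun z => E_entry i x z * E_entry i z y)) /= sum_E_entry //.
rewrite /E_entry swapK yA andbT.
have [syA|syA] := boolP (swap_tab i y \in A); last first.
  rewrite andbF !addr0; case: eqP => _; last by rewrite mul0r.
  by rewrite alpha_idem.
rewrite andbT alpha_swap // beta_swap //.
have [->|nxy] := eqVneq x y.
  rewrite [y == swap_tab i y]eq_sym swap_neq // addr0 add0r beta_sqr; ring.
by case: eqP => _; ring.
Qed.

Lemma Emx_sym i : (Emx s k (k + l) lam i)^T = Emx s k (k + l) lam i.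
Proof.
apply/matrixP => a b; rewrite !mxE.
have yA := enum_valP b; have xA := enum_valP a.
move: (enum_val a) (enum_val b) xA yA => x y xA yA.
rewrite [y == x]eq_sym; congr (_ + _); first by case: eqP => // ->.
have -> : (y == swap_tab i x) = (x == swap_tab i y).
  by apply/eqP/eqP => ->; rewrite swapK.
by case: eqP => //= e; rewrite e swapK yA -e xA e beta_swap.
Qed.

Lemma JW_gen_mulVmx i :
  JW_gen s k (k + l) lam i *m ((s ^- 2)%:M - (1 + s ^- 2) *: Emx s k (k + l) lam i) =
  1%:M :> 'M_#|A|.
Proof.
have s0 : s ^+ 2 != 0 by rewrite expf_neq0 // (prim_root_eq0 s_prim); lia.
exact: (two_eigenvalue_inv _ (Emx_idem i)).
Qed.

Lemma JW_gen_unit i : JW_gen s k (k + l) lam i \in unitmx.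
Proof. by have /mulmx1_unit[] := JW_gen_mulVmx i. Qed.

(** With [q = s ^+ 2], the right-hand side is [q - (1 + q) (1 - E_i)]. *)
Lemma JW_gen_dual i :
  - s ^+ 2 *: (invmx (JW_gen s k (k + l) lam i))^T =
  (1 + s ^+ 2) *: Emx s k (k + l) lam i - 1%:M.
Proof.
have s0 : s ^+ 2 != 0 by rewrite expf_neq0 // (prim_root_eq0 s_prim); lia.
have -> : invmx (JW_gen s k (k + l) lam i) =
    (s ^- 2)%:M - (1 + s ^- 2) *: Emx s k (k + l) lam i.
  by rewrite -[RHS](mulKmx (JW_gen_unit i)) JW_gen_mulVmx mulmx1.
rewrite linearB linearZ /= tr_scalar_mx Emx_sym scalerBr scale_scalar_mx scalerA.
rewrite mulNr mulfV // mulNr mulrDr mulfV // mulr1 scaleNr opprK [s ^+ 2 + 1]addrC.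
by rewrite raddfN [LHS]addrC.
Qed.

Variable lam' : seq nat.
Hypothesis sz' : size lam' = l.
Hypothesis lamE : forall j, (j < l)%N -> nth 0%N lam' j = rc k l (nth 0%N lam) j.
Hypothesis lam_adm : adm k l (nth 0%N lam).
Local Notation A' := (Atab l (k + l) n lam').
Local Notation conj := (@conj_tab k l n l_gt0).
Local Notation conj' := (@conj_tab l k n k_gt0).

Lemma conj_mem t : t \in A -> conj t \in A'.
Proof.
move=> tA; rewrite [(k + l)%N]addnC.
exact: (conj_tab_Atab l_gt0 k_gt0 sz tA sz' lamE).
Qed.

Lemma conj'_mem u : u \in A' -> conj' u \in A.
Proof.
move=> u_in; have uA : u \in Atab l (l + k) n lam' by rewrite addnC.
apply: (conj_tab_Atab k_gt0 l_gt0 sz' uA) => // j jk.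
by rewrite (eq_rc _ _ lamE) rc_involutive.
Qed.

Lemma conjK t : t \in A -> conj' (conj t) = t.
Proof. exact: conj_tabK. Qed.

Lemma conj'K u : u \in A' -> conj (conj' u) = u.
Proof. by rewrite addnC; apply: conj_tabK. Qed.

Lemma alpha_conj t i : t \in A -> alpha s (conj t) i = 1 - alpha s t i.
Proof.
move=> tA; rewrite -![alpha _ _ _]/(qratio _ _).
have [z ->] := dcont_conj l_gt0 k_gt0 sz tA i.
rewrite (qratio_period r_gt1 s_prim) (qratioN r_gt1 s_prim) //.
exact: (dcont_bounds k_gt0 l_gt0 sz).
Qed.

Lemma beta_conj t i : t \in A -> beta s (conj t) i = beta s t i.
Proof. by move=> tA; rewrite /beta alpha_conj // subKr mulrC. Qed.

Lemma conj_swap_mem i t : t \in A -> (swap_tab i (conj t) \in A') = (swap_tab i t \in A).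
Proof.
move=> tA; rewrite -conj_tab_swap; apply/idP/idP => [/conj'_mem|]; last exact: conj_mem.
by rewrite !conj_tab_swap conjK.
Qed.

Definition conj_mx : 'M[algC]_(#|A'|, #|A|) :=
  \matrix_(a, b) (if enum_val a == conj (enum_val b) then alt_weight (enum_val b) else 0).

Definition conj_mx_inv : 'M[algC]_(#|A|, #|A'|) :=
  \matrix_(b, a) (if enum_val a == conj (enum_val b) then (alt_weight (enum_val b))^-1 else 0).

Lemma conj_mxV : conj_mx *m conj_mx_inv = 1%:M.
Proof.
apply/matrixP => a a'; rewrite !mxE; under eq_bigr do rewrite !mxE.
rewrite -(inj_eq enum_val_inj).
have xA := enum_valP a; have yA := enum_valP a'.
move: (enum_val a) (enum_val a') xA yA => x y xA yA.
rewrite -(big_enum_val (fun z => (if x == conj z then alt_weight z else 0) *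
   (if y == conj z then (alt_weight z)^-1 else 0))) /=.
rewrite (bigD1 (conj' x)) ?conj'_mem //= conj'K // eqxx [y == x]eq_sym.
rewrite big1 ?addr0 => [|z /andP[zA]].
  case: eqP => _; last by rewrite mulr0.
  by rewrite mulfV // alt_weight_neq0 //; apply: Atab_inj (conj'_mem xA).
by case: (x =P conj z) => [->|_]; [rewrite conjK ?eqxx | rewrite mul0r].
Qed.

Lemma conj_Vmx : conj_mx_inv *m conj_mx = 1%:M.
Proof.
apply/matrixP => a a'; rewrite !mxE; under eq_bigr do rewrite !mxE.
rewrite -(inj_eq enum_val_inj).
have xA := enum_valP a; have yA := enum_valP a'.
move: (enum_val a) (enum_val a') xA yA => x y xA yA.
rewrite -(big_enum_val (fun z => (if z == conj x then (alt_weight x)^-1 else 0) *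
   (if z == conj y then alt_weight y else 0))) /=.
rewrite (bigD1 (conj x)) ?conj_mem //= eqxx big1 ?addr0; last first.
  by move=> z /andP[_ /negPf ->]; rewrite mul0r.
rewrite (can_in_eq conjK) //; case: eqP => [->|_]; last by rewrite mulr0.
by rewrite mulVf // alt_weight_neq0 //; apply: Atab_inj yA.
Qed.

(** The diagonal parts match since [alpha] becomes [1 - alpha] under conjugation. Off the diagonal
    [beta] is unchanged, and the opposite weights of [y] and its swap supply the minus sign. *)
Lemma conj_mx_Emx i : conj_mx *m Emx s k (k + l) lam i =
  conj_mx - Emx s l (k + l) lam' i *m conj_mx.
Proof.
apply/matrixP => a b; rewrite !mxE.
under eq_bigr do rewrite !mxE -/(E_entry i _ _).
under [in RHS]eq_bigr do rewrite !mxE.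
have xA := enum_valP a; have yA := enum_valP b.
move: (enum_val a) (enum_val b) xA yA => x y xA yA.
rewrite -(big_enum_val (fun z => (if x == conj z then alt_weight z else 0) * E_entry i z y)) /=.
rewrite -(big_enum_val (fun z => ((if x == z then alpha s z i else 0) +
   (if (x == swap_tab i z) && (swap_tab i z \in A') then beta s z i else 0)) *
   (if z == conj y then alt_weight y else 0))) /=.
rewrite sum_E_entry // [in RHS](bigD1 (conj y)) ?conj_mem //= eqxx big1 ?addr0; last first.
  by move=> z /andP[_ /negPf ->]; rewrite mulr0.
rewrite alpha_conj // beta_conj // conj_swap_mem // -conj_tab_swap.
have [syA|syA] := boolP (swap_tab i y \in A); last first.
  by rewrite andbF !addr0; case: eqP => _; ring.
rewrite andbT alt_weight_swap; case: eqP => _; case: eqP => _; ring.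
Qed.

Lemma conj_mx_JW_gen i :
  conj_mx *m (- s ^+ 2 *: (invmx (JW_gen s k (k + l) lam i))^T) =
  JW_gen s l (k + l) lam' i *m conj_mx.
Proof.
rewrite JW_gen_dual mulmxBr -scalemxAr conj_mx_Emx mulmx1 /JW_gen mulmxBl mul_scalar_mx.
rewrite -scalemxAl scalerBr scalerDl scale1r addrAC; congr (_ - _).
by rewrite addrC addKr.
Qed.

Lemma JW_rep_equiv :
  rep_equiv (@JW_rep s l (k + l) n lam') (twisted_dual s (@JW_rep s k (k + l) n lam)).
Proof.
exists conj_mx, conj_mx_inv; split; [exact: conj_mxV|exact: conj_Vmx|].
apply: (twisted_dual_intertwine _ conj_mxV conj_Vmx JW_gen_unit conj_mx_JW_gen).
by rewrite (prim_root_eq0 s_prim); lia.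
Qed.

End Matrices.

Theorem theorem3p3 (r k : nat) (s : algC) (lam : seq nat) :
  (3 <= r)%N ->
  (s = r.-root (-1) \/ s = (r.-root (-1))^*) ->
  (1 <= k <= r.-1)%N ->
  admissible k r lam ->
  admissible (r - k) r (rconj r k lam) /\
  rep_equiv (@JW_rep s (r - k) r (sumn lam) (rconj r k lam))
            (twisted_dual s (@JW_rep s k r (sumn lam) lam)).
Proof.
move=> r_ge3 sE /andP[k_gt0 k_lt].
have l_gt0 : (0 < r - k)%N by lia.
have rE : (k + (r - k))%N = r by lia.
have s_prim : (r + r).-primitive_root s.
  have prim := rootCN1_prim (ltnW r_ge3).
  by case: sE => ->; rewrite ?fmorph_primitive_root.
have sz' : size (rconj r k lam) = (r - k)%N by rewrite size_map size_iota.
have lamE i : (i < r - k)%N ->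
    nth 0%N (rconj r k lam) i = rc k (r - k) (nth 0%N lam) i.
  by move=> il; rewrite (nth_map 0%N) ?size_iota // nth_iota.
(* From here only the length and entries of the conjugate diagram matter; abstracting it and [r - k]
   allows [r] to be replaced by [k + l]. *)
move: (rconj r k lam) l_gt0 rE sz' lamE => lam'.
move: (r - k)%N => l l_gt0 rE sz' lamE; subst r.
case/admissibleP => sz lam_adm; split; last exact: JW_rep_equiv.
rewrite addnC; apply/admissibleP; split=> //.
by apply: eq_adm (rc_adm k (nth 0%N lam) l_gt0) => // j jl; rewrite lamE.
Qed.
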